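(* Let $n\ge 1$ and $p\ge 1$ be integers. Let $T\bar{\mu}_{p-1}\in\Omega^{p}(PT^n(p-1))$ be the form $$T\bar{\mu}_{p-1}= (-1)^{\frac{p(p+1)}{2}}\,\frac{1}{p!}\left(\frac{1}{2\pi}\right)^p\sum_{1\le k_0<\cdots<k_{p-1}\le n}\det\left(d\theta^s_{k_t}\right)_{0\le s,t\le p-1}.$$ Then $T\bar{\mu}_{p-1}$ is the Chern-Simons form of the $p$-th Chern class of the universal torus bundle; that is, in the total complex $\Omega^*(PT^n)$, $$(d'+d'')\,T\bar{\mu}_{p-1}=\bar{\mu}_p ,$$ where $\bar{\mu}_p\in\Omega^p(PT^n(p))$ is the cocycle $$\bar{\mu}_{p}= (-1)^{\frac{p(p-1)}{2}}\,\frac{1}{p!}\left(\frac{1}{2\pi}\right)^p\sum_{1\le k_0<\cdots<k_{p-1}\le n}\det\left(d\theta^s_{k_t}-d\theta^{s+1}_{k_t}\right)_{0\le s,t\le p-1}$$ corresponding to the $p$-th Chern class of the universal torus bundle.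
   Context: For a Lie group $G$, $PG$ is the simplicial manifold with $PG(q)=G^{q+1}\ni(g_0,\dots,g_q)$ and face operators $\bar{\varepsilon}_i:PG(q)\to PG(q-1)$, $\bar{\varepsilon}_i(g_0,\dots,g_q)=(g_0,\dots,g_{i-1},g_{i+1},\dots,g_q)$, $0\le i\le q$. The double complex is $\Omega^{q,r}(PG)=\Omega^r(PG(q))$ (smooth differential forms), with $d'=\sum_{i=0}^{q+1}(-1)^i\bar{\varepsilon}_i^*:\Omega^r(PG(q))\to\Omega^r(PG(q+1))$ and $d''=(-1)^q\times$(exterior differential) on $\Omega^r(PG(q))$; $\Omega^*(PG)$ is its total complex with differential $d'+d''$. Here $G=T^n$ is the $n$-torus of diagonal unitary $n\times n$ matrices. The $s$-th factor of $PT^n(q)$ is written $g_s=\mathrm{diag}(\exp(i\theta^s_1),\dots,\exp(i\theta^s_n))$, $s=0,\dots,q$, so that $d\theta^s_k$ are globally defined closed real 1-forms on $PT^n(q)$. For a matrix $(a_{s,t})_{0\le s,t\le p-1}$ of 1-forms, the determinant is $$\det(a_{s,t})_{0\le s,t\le p-1}=\sum_{\sigma\in\mathfrak{S}_p}\mathrm{sgn}(\sigma)\,a_{\sigma(0),0}\wedge a_{\sigma(1),1}\wedge\cdots\wedge a_{\sigma(p-1),p-1},$$ with $\mathfrak{S}_p$ the permutations of $\{0,\dots,p-1\}$; i.e. the factors are multiplied in increasing order of $t$. With this convention the determinant is multilinear and alternating in the vectors $(a_{s,0},\dots,a_{s,p-1})$, $s=0,\dots,p-1$. An empty sum is zero.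 A Chern-Simons form of a cocycle in $\Omega^*(PG)$ is a cochain of total degree one less whose image under $d'+d''$ is that cocycle. *)

(* Defs.v *)
From HB Require Import structures.
From mathcomp Require Import all_boot all_order all_fingroup all_algebra complex.
From mathcomp Require Import boolp classical_sets functions reals topology.
From mathcomp Require Import normedtype derive trigo.

Set Implicit Arguments.
Unset Strict Implicit.
Unset Printing Implicit Defensive.

Import Order.TTheory GRing.Theory Num.Theory.
Import numFieldNormedType.Exports.
Local Open Scope ring_scope.
Local Open Scope complex_scope.

Section Smooth.
Variables (R : realType) (V : normedModType R).

Fixpoint iterD (vs : seq V) (f : V -> R) : V -> R :=
  if vs is v :: vs' then fun a => 'D_v (iterD vs' f) a else f.

(* C^oo: every iterated directional derivative is (Frechet) differentiable. *)
Definition smoothV (f : V -> R) : Prop :=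
  forall (vs : seq V) (a : V), differentiable (iterD vs f) a.

Lemma smoothV_diff f a : smoothV f -> differentiable f a.
Proof. by move=> fs; exact: (fs [::] a). Qed.

Lemma smoothV_derivable f a v : smoothV f -> derivable f a v.
Proof. by move=> fs; apply: diff_derivable; exact: smoothV_diff. Qed.

Lemma iterD_rcons vs v f : iterD (rcons vs v) f = iterD vs (fun a => 'D_v f a).
Proof. by elim: vs => //= w vs ->. Qed.

Lemma smoothV_D f v : smoothV f -> smoothV (fun a => 'D_v f a).
Proof. by move=> fs vs a; rewrite -iterD_rcons; exact: fs. Qed.

Inductive smooth_alg : (V -> R) -> Prop :=
| SAbase f of smoothV f : smooth_alg f
| SAcst c : smooth_alg (cst c)
| SAadd f g of smooth_alg f & smooth_alg g : smooth_alg (f + g)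
| SAmul f g of smooth_alg f & smooth_alg g : smooth_alg (f * g).

Lemma smooth_alg_diff f : smooth_alg f -> forall a, differentiable f a.
Proof.
move=> + a; elim=> {f} [f fs|c|f g _ fd _ gd|f g _ fd _ gd].
- exact: smoothV_diff.
- exact: differentiable_cst.
- exact: differentiableD.
- exact: differentiableM.
Qed.

Lemma smooth_alg_D f v : smooth_alg f -> smooth_alg (fun a => 'D_v f a).
Proof.
elim=> {f} [f fs|c|f g fs fd gs gd|f g fs fd gs gd].
- by apply: SAbase; exact: smoothV_D.
- rewrite (_ : (fun _ => _) = cst 0); first exact: SAcst.
  by apply/funext => a; rewrite derive_cst.
- rewrite (_ : (fun _ => _) = (fun a => 'D_v f a) + (fun a => 'D_v g a)).
    exact: SAadd.
  apply/funext => a; rewrite deriveD //; apply: diff_derivable;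
  exact: smooth_alg_diff.
- rewrite (_ : (fun _ => _) =
    f * (fun a => 'D_v g a) + g * (fun a => 'D_v f a)).
    by apply: SAadd; apply: SAmul.
  apply/funext => a; rewrite deriveM //; apply: diff_derivable;
  exact: smooth_alg_diff.
Qed.

Lemma smooth_alg_smoothV f : smooth_alg f -> smoothV f.
Proof.
move=> fs vs; elim/last_ind: vs f fs => [|vs v IH] f fs a.
  exact: smooth_alg_diff.
by rewrite iterD_rcons; apply: IH; exact: smooth_alg_D.
Qed.

Lemma smoothV_cst (c : R) : smoothV (fun=> c).
Proof. by apply: smooth_alg_smoothV; exact: SAcst. Qed.

Lemma smoothV_add f g : smoothV f -> smoothV g -> smoothV (fun a => f a + g a).
Proof.
by move=> fs gs; apply: smooth_alg_smoothV; apply: SAadd; exact: SAbase.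
Qed.

Lemma smoothV_mul f g : smoothV f -> smoothV g -> smoothV (fun a => f a * g a).
Proof.
by move=> fs gs; apply: smooth_alg_smoothV; apply: SAmul; exact: SAbase.
Qed.

Lemma smoothV_scale k f : smoothV f -> smoothV (fun a => k * f a).
Proof. by move=> fs; apply: smoothV_mul => //; exact: smoothV_cst. Qed.

Lemma smoothV_sum I (s : seq I) (P : pred I) (f : I -> V -> R) :
  (forall i, smoothV (f i)) -> smoothV (fun a => \sum_(i <- s | P i) f i a).
Proof.
move=> fs; elim: s => [|i s IH].
  under eq_fun do rewrite big_nil.
  exact: smoothV_cst.
under eq_fun do rewrite big_cons.
by case: (P i) => //; apply: smoothV_add.
Qed.

End Smooth.

Lemma smoothV_comp_lin (R : realType) (V W : normedModType R)
    (h : {linear V -> W}) (f : W -> R) :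
  continuous h -> smoothV f -> smoothV (f \o h).
Proof.
move=> hc fs vs a.
have -> : iterD vs (f \o h) = iterD (map h vs) f \o h.
  elim: vs => //= v vs ->; apply/funext => b /=.
  by rewrite /derive; under eq_fun do rewrite /= linearP.
by apply: differentiable_comp => //; exact: linear_differentiable.
Qed.

Lemma row'_continuous (R : realType) (m n : nat) (i : 'I_m.+1) :
  continuous (fun A : 'M[R]_(m.+1, n) => row' i A : 'M[R]_(m, n)).
Proof.
move=> A B [P AP PB].
exists (fun s' k => [set y | forall s, lift i s = s' -> P s k y])%classic.
  move=> s' k /=.
  apply: (@filter_forall _ _ (fun s => [set y | lift i s = s' -> P s k y])%classic
    (nbhs (A s' k)) (nbhs_filter _)) => s.
  have [<-|ne] := eqVneq (lift i s) s'.
    have := AP s k; rewrite mxE => APs.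
    by apply: (filterS _ APs) => y Py _.
  by apply: filterE => y /= e; rewrite e eqxx in ne.
move=> N NP; apply: PB => s k; rewrite mxE; exact: NP.
Qed.

Section Torus.
Variables (R : realType) (n : nat).

Record torus := Torus {
  torus_mx :> 'M[R[i]]_n;
  torusP : is_diag_mx torus_mx && (torus_mx \is unitarymx) }.

HB.instance Definition _ := [isSub for torus_mx].

Definition expT_mx (a : 'rV[R]_n) : 'M[R[i]]_n :=
  diag_mx (\row_k (cos (a 0 k) +i* sin (a 0 k))).

Lemma expT_subproof a : is_diag_mx (expT_mx a) && (expT_mx a \is unitarymx).
Proof.
rewrite diag_mx_is_diag /=; apply/unitarymxP.
rewrite /expT_mx tr_diag_mx map_diag_mx mulmx_diag; apply/matrixP => i j.
rewrite !mxE; congr (_ *+ _).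
apply/eqP; rewrite eq_complex /= mulrN opprK -!expr2 cos2Dsin2 eqxx /=.
by rewrite mulrN mulrC addrC subrr.
Qed.

Definition expT (a : 'rV[R]_n) : torus := Torus (expT_subproof a).

Lemma mulT_subproof (g h : torus) :
  is_diag_mx (g *m h) && (g *m h \is unitarymx).
Proof.
case: g h => [g /andP[/is_diag_mxP gd gu]] [h /andP[/is_diag_mxP hd hu]] /=.
rewrite mul_unitarymx // andbT; apply/is_diag_mxP => i j ij; rewrite mxE.
apply: big1 => k _; have [ik|ik] := eqVneq (i : nat) k.
  by rewrite hd ?mulr0 // -ik.
by rewrite gd ?mul0r.
Qed.

Definition mulT (g h : torus) : torus := Torus (mulT_subproof g h).

Lemma expTD a b : expT (a + b) = mulT (expT a) (expT b).
Proof.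
apply: val_inj => /=; rewrite mulmx_diag; congr diag_mx.
apply/rowP => k; rewrite !mxE cosD sinD.
by apply/eqP; rewrite eq_complex /= eqxx /= addrC (mulrC (sin _)) eqxx.
Qed.

Lemma unit_circle (c s : R) : c ^+ 2 + s ^+ 2 = 1 ->
  exists t, cos t = c /\ sin t = s.
Proof.
move=> cs.
have c1 : -1 <= c <= 1.
  rewrite -ler_norml -(@ler_pXn2r _ 2) ?nnegrE //.
  by rewrite expr1n real_normK ?num_real // -cs lerDl sqr_ge0.
have c1' : c \in `[(-1), 1] by rewrite in_itv.
have s2 : Num.sqrt (1 - c ^+ 2) = `|s|.
  by rewrite -cs addrAC subrr add0r sqrtr_sqr.
have [s0|s0] := leP 0 s.
  exists (acos c); split; first exact: acosK.
  by rewrite sin_acos // s2 ger0_norm.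
exists (- acos c); rewrite cosN sinN; split; first exact: acosK.
by rewrite sin_acos // s2 ltr0_norm // opprK.
Qed.

Lemma expT_surj (g : torus) : exists a, expT a = g.
Proof.
have /andP[/diag_mxP[d gE] /unitarymxP gu] := torusP g.
have dk k : exists t, cos t = complex.Re (d 0 k) /\ sin t = complex.Im (d 0 k).
  apply: unit_circle.
  move/matrixP/(_ k k): gu; rewrite gE tr_diag_mx map_diag_mx mulmx_diag.
  rewrite !mxE eqxx !mulr1n; case: (d 0 k) => x y /=.
  by move=> /eqP; rewrite eq_complex /= => /andP[/eqP + _];
    rewrite mulrN opprK -!expr2.
exists (\row_k sval (cid (dk k))); apply: val_inj => /=; rewrite gE.
congr diag_mx; apply/rowP => k; rewrite !mxE.
by case: cid => t /= [-> ->]; case: (d 0 k).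
Qed.

End Torus.

Section Forms.
Variables (R : realType) (n : nat).

(* PT q is PT^n(q), with points x = (g_0, ..., g_q).  The tangent bundle is
   trivialised by the invariant vector fields d/dtheta^s_k: the tangent vector
   \sum_(s, k) v s k * d/dtheta^s_k is encoded by the matrix v. *)
Definition PT (q : nat) := 'I_q.+1 -> torus R n.
Definition tangent (q : nat) := 'M[R]_(q.+1, n).

Definition expPT q (a : tangent q) : PT q := fun s => expT (row s a).
Definition mulPT q (x y : PT q) : PT q := fun s => mulT (x s) (y s).

Lemma expPTD q (a b : tangent q) : expPT (a + b) = mulPT (expPT a) (expPT b).
Proof. by apply/funext => s; rewrite /expPT linearD expTD. Qed.

Lemma expPT_surj q (x : PT q) : exists a, expPT a = x.
Proof.
have h s : exists a, expT a = x s by exact: expT_surj.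
exists (\matrix_s sval (cid (h s))); apply/funext => s.
by rewrite /expPT rowK; case: cid.
Qed.

(* f is C^oo on the torus iff it is C^oo in the angles, since expPT is the
   universal covering, a surjective local diffeomorphism. *)
Definition smooth q (f : PT q -> R) : Prop := smoothV (f \o @expPT q).

(* derivative of f at x along the invariant vector field
   \sum_(s, k) v s k * d/dtheta^s_k *)
Definition Dinv q (v : tangent q) (f : PT q -> R) (x : PT q) : R :=
  derive1 (fun t : R => f (mulPT x (expPT (t *: v)))) 0.

Lemma Dinv_expPT q v (f : PT q -> R) a :
  Dinv v f (expPT a) = 'D_v (f \o @expPT q) a.
Proof.
rewrite /Dinv derive1E /derive.
set g := (X in lim (fmap X _)); set h := (X in _ = lim (fmap X _)).
suff -> : g = h by [].
apply/funext => t; rewrite /g /h /=.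
by rewrite [t *: 1]mulr1 addr0 -!expPTD scale0r addr0 [a + _]addrC.
Qed.

Lemma smooth_Dinv q v (f : PT q -> R) : smooth f -> smooth (Dinv v f).
Proof.
move=> fs; rewrite /smooth (_ : _ \o _ = fun a => 'D_v (f \o @expPT q) a).
  exact: smoothV_D.
by apply/funext => a /=; rewrite Dinv_expPT.
Qed.

Lemma Dinv_linearl q c u v (f : PT q -> R) x : smooth f ->
  Dinv (c *: u + v) f x = c * Dinv u f x + Dinv v f x.
Proof.
move=> fs; have [a <-] := expPT_surj x; rewrite !Dinv_expPT.
by rewrite !deriveE ?linearP //; exact: smoothV_diff.
Qed.

Lemma Dinv_linearr q v c (f g : PT q -> R) x : smooth f -> smooth g ->
  Dinv v (fun y => c * f y + g y) x = c * Dinv v f x + Dinv v g x.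
Proof.
move=> fs gs; have [a <-] := expPT_surj x; rewrite !Dinv_expPT.
rewrite (_ : _ \o _ = c *: (f \o @expPT q) + (g \o @expPT q)) //.
rewrite deriveD ?deriveZ //; last exact: smoothV_derivable.
  exact: smoothV_derivable.
by apply: derivableZ; exact: smoothV_derivable.
Qed.

Lemma Dinv_scale q v c (f : PT q -> R) x : smooth f ->
  Dinv v (fun y => c * f y) x = c * Dinv v f x.
Proof.
move=> fs; have [a <-] := expPT_surj x; rewrite !Dinv_expPT.
rewrite (_ : _ \o _ = c *: (f \o @expPT q)) //.
by rewrite deriveZ //; exact: smoothV_derivable.
Qed.

Record is_form q r (w : PT q -> ('I_r -> tangent q) -> R) : Prop := IsForm {
  form_smooth : forall v, smooth (fun x => w x v);
  form_linear : forall x (v : 'I_r -> tangent q) j c a b,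
    w x [eta v with j |-> c *: a + b] =
    c * w x [eta v with j |-> a] + w x [eta v with j |-> b];
  form_alt : forall x (v : 'I_r -> tangent q) (s : 'S_r),
    w x (v \o s) = (-1) ^+ s * w x v }.

Definition form_pred q r : {pred PT q -> ('I_r -> tangent q) -> R} :=
  fun w => `[< is_form w >].
Arguments form_pred : clear implicits.

Lemma form_pred_submod q r : submod_closed (form_pred q r).
Proof.
split=> [|c w1 w2 /asboolP[s1 l1 a1] /asboolP[s2 l2 a2]]; apply/asboolP.
  split=> [v|x v j c a b|x v s]; first exact: smoothV_cst.
    by rewrite [RHS]addr0 mulr0.
  by rewrite mulr0.
split=> [v|x v j d a b|x v s].
- exact: smoothV_add (smoothV_scale c (s1 v)) (s2 v).
- rewrite !fctE l1 l2 /=.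
  rewrite -![c *: _]/(c * _) !mulrDr !addrA; congr (_ + _).
  by rewrite addrAC mulrCA.
- by rewrite !fctE a1 a2 mulrDr -![c *: _]/(c * _) mulrCA.
Qed.

HB.instance Definition _ q r :=
  GRing.isSubmodClosed.Build R _ (form_pred q r) (form_pred_submod q r).

(* Omega^r(PT^n(q)) *)
Record form q r := Form {
  form_val :> PT q -> ('I_r -> tangent q) -> R;
  form_valP : form_val \in form_pred q r }.

HB.instance Definition _ q r := [isSub for @form_val q r].
HB.instance Definition _ q r := [Choice of form q r by <:].
HB.instance Definition _ q r := [SubChoice_isSubLmodule of form q r by <:].

Lemma formP q r (w : form q r) : is_form w.
Proof. exact: (asboolP _ (form_valP w)). Qed.

Lemma is_form_in q r w : is_form w -> w \in form_pred q r.
Proof. by move=> wf; apply/asboolP. Qed.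

Definition mk_form q r w (wf : is_form w) : form q r := Form (is_form_in wf).

Lemma form_eqP q r (w1 w2 : form q r) : (forall x v, w1 x v = w2 x v) -> w1 = w2.
Proof.
by move=> e; apply: val_inj; apply/funext => x; apply/funext => v; exact: e.
Qed.

Lemma eta_comp (I J : eqType) T (v : I -> T) (f : J -> I) (j : J) a :
  injective f -> [eta v with f j |-> a] \o f = [eta (v \o f) with j |-> a].
Proof. by move=> fi; apply/funext => i /=; rewrite inj_eq. Qed.

Lemma eta_comp_out (I J : eqType) T (v : I -> T) (f : J -> I) (i : I) a :
  (forall j, f j != i) -> [eta v with i |-> a] \o f = v \o f.
Proof. by move=> fi; apply/funext => j /=; rewrite (negPf (fi j)). Qed.

(* dtheta^s_k is dual to the frame d/dtheta^s_k. *)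
Definition dtheta_fun q (s : 'I_q.+1) (k : 'I_n) (x : PT q)
  (v : 'I_1 -> tangent q) : R := v ord0 s k.

Lemma dtheta_is_form q s k : is_form (@dtheta_fun q s k).
Proof.
split=> [v|x v j c a b|x v t]; first exact: smoothV_cst.
  by rewrite /dtheta_fun /= !ord1 !mxE.
have -> : t = 1%g by apply/permP => i; rewrite !ord1.
by rewrite odd_perm1 mul1r /dtheta_fun /= perm1.
Qed.

Definition dtheta q s k : form q 1 := mk_form (@dtheta_is_form q s k).

(* Normalised so that (a /\ b)(u, v) = a(u) * b(v) - a(v) * b(u) for
   1-forms a and b. *)
Definition wedge_fun q r1 r2 (w1 : form q r1) (w2 : form q r2) (x : PT q)
    (v : 'I_(r1 + r2) -> tangent q) : R :=
  (r1`! * r2`!)%:R^-1 * \sum_(s : 'S_(r1 + r2)) (-1) ^+ s *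
    (w1 x (fun i => v (s (lshift r2 i))) * w2 x (fun j => v (s (rshift r1 j)))).

Lemma wedge_is_form q r1 r2 w1 w2 : is_form (@wedge_fun q r1 r2 w1 w2).
Proof.
have [s1 l1 a1] := formP w1; have [s2 l2 a2] := formP w2.
split=> [v|x v j c a b|x v t].
- apply: smoothV_scale; apply: smoothV_sum => s.
  by apply: smoothV_scale; apply: smoothV_mul; [exact: s1|exact: s2].
- rewrite /wedge_fun (mulrCA c) -mulrDr; congr (_ * _).
  rewrite mulr_sumr -big_split /=; apply: eq_bigr => s _.
  rewrite (mulrCA c) -mulrDr; congr (_ * _).
  have e1 u : (fun i => [eta v with j |-> u] (s (lshift r2 i))) =
    [eta v with j |-> u] \o (s \o @lshift r1 r2) by [].
  have e2 u : (fun i => [eta v with j |-> u] (s (rshift r1 i))) =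
    [eta v with j |-> u] \o (s \o @rshift r1 r2) by [].
  have inj1 : injective (s \o @lshift r1 r2).
    by apply: inj_comp; [exact: perm_inj|exact: lshift_inj].
  have inj2 : injective (s \o @rshift r1 r2).
    by apply: inj_comp; [exact: perm_inj|exact: rshift_inj].
  rewrite !e1 !e2; have [k ej] : exists k, j = s k.
    by exists (s^-1%g j); rewrite permKV.
  case: (split_ordP k) ej => k' -> ej; rewrite ej.
  + have out u : [eta v with s (lshift r2 k') |-> u] \o (s \o @rshift r1 r2) =
        v \o (s \o @rshift r1 r2).
      by apply: eta_comp_out => i /=; rewrite (inj_eq perm_inj) eq_rlshift.
    have inn u : [eta v with s (lshift r2 k') |-> u] \o (s \o @lshift r1 r2) =
        [eta (v \o (s \o @lshift r1 r2)) with k' |-> u].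
      exact: (eta_comp _ _ _ inj1).
    by rewrite !out !inn l1 mulrDl mulrA.
  + have out u : [eta v with s (rshift r1 k') |-> u] \o (s \o @lshift r1 r2) =
        v \o (s \o @lshift r1 r2).
      by apply: eta_comp_out => i /=; rewrite (inj_eq perm_inj) eq_lrshift.
    have inn u : [eta v with s (rshift r1 k') |-> u] \o (s \o @rshift r1 r2) =
        [eta (v \o (s \o @rshift r1 r2)) with k' |-> u].
      exact: (eta_comp _ _ _ inj2).
    by rewrite !out !inn l2 mulrDr mulrCA.
- rewrite /wedge_fun mulrCA; congr (_ * _); rewrite mulr_sumr.
  rewrite [RHS](reindex_inj (mulIg t)) /=; apply: eq_bigr => s _.
  rewrite [RHS]mulrA -signr_addb odd_permM addbC -addbA addbb addbF.
  congr (_ * _).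
  by congr (w1 x _ * w2 x _); apply/funext => i; rewrite permM.
Qed.

Definition wedge q r1 r2 (w1 : form q r1) (w2 : form q r2) : form q (r1 + r2) :=
  mk_form (wedge_is_form w1 w2).

Lemma form1_is_form q : is_form (fun (_ : PT q) (_ : 'I_0 -> tangent q) => 1 : R).
Proof.
split=> [v|x v [] //|x v s]; first exact: smoothV_cst.
have -> : s = 1%g by apply/permP => -[].
by rewrite odd_perm1 mul1r.
Qed.

Definition form1 q : form q 0 := mk_form (form1_is_form q).

(* a_0 /\ (a_1 /\ ... (a_(p-1) /\ 1)) *)
Fixpoint wedge_prod q p : ('I_p -> form q 1) -> form q p :=
  if p is p'.+1
  then fun a => wedge (a ord0) (wedge_prod (fun t => a (lift ord0 t)))
  else fun=> form1 q.

Definition det_form q p (a : 'I_p -> 'I_p -> form q 1) : form q p :=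
  \sum_(s : 'S_p) (-1) ^+ s *: wedge_prod (fun t => a (s t) t).

(* Exterior derivative: Cartan's formula, evaluated on invariant vector fields;
   the terms with Lie brackets vanish because these fields commute. *)
Definition ext_fun q r (w : form q r) (x : PT q) (v : 'I_r.+1 -> tangent q) : R :=
  \sum_(i < r.+1) (-1) ^+ i * Dinv (v i) (fun y => w y (v \o lift i)) x.

Lemma ext_is_form q r w : is_form (@ext_fun q r w).
Proof.
have [sw lw aw] := formP w.
split=> [v|x v j c a b|x v t].
- by apply: smoothV_sum => i; apply: smoothV_scale; exact/smooth_Dinv/sw.
- rewrite /ext_fun mulr_sumr -big_split /=; apply: eq_bigr => i _.
  rewrite (mulrCA c) -mulrDr; congr (_ * _).
  have [->|ji] := eqVneq j i.
    have out u : [eta v with i |-> u] \o lift i = v \o lift i.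
      by apply: eta_comp_out => k; rewrite eq_sym neq_lift.
    by rewrite !out Dinv_linearl //; exact: sw.
  have [k jk|e] := unliftP i j; last by rewrite e eqxx in ji.
  rewrite jk.
  rewrite -Dinv_linearr; [|exact: sw|exact: sw].
  congr (Dinv _ _ x); apply/funext => y.
  by rewrite !(eta_comp _ _ _ (@lift_inj _ i)) lw.
- rewrite /ext_fun mulr_sumr [RHS](reindex_inj (@perm_inj _ t)) /=.
  apply: eq_bigr => i _.
  have ui k : exists k', t (lift i k) = lift (t i) k'.
    have [k' ->|/perm_inj e] := unliftP (t i) (t (lift i k)); first by exists k'.
    by have := neq_lift i k; rewrite e eqxx.
  pose f k := sval (cid (ui k)).
  have fE k : t (lift i k) = lift (t i) (f k) by rewrite /f; case: cid.
  have fi : injective f.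
    by move=> k l e; apply: (@lift_inj _ i); apply: (@perm_inj _ t); rewrite !fE e.
  pose s := perm fi.
  have ts : t = lift_perm i (t i) s.
    apply/permP => k; have [k' ->|->] := unliftP i k; last by rewrite lift_perm_id.
    by rewrite lift_perm_lift permE fE.
  have -> : (v \o t) \o lift i = (v \o lift (t i)) \o s.
    by apply/funext => k /=; rewrite fE permE.
  have -> : (fun y => w y ((v \o lift (t i)) \o s)) =
      (fun y => (-1) ^+ s * w y (v \o lift (t i))).
    by apply/funext => y; rewrite aw.
  rewrite Dinv_scale; last exact: sw.
  rewrite !mulrA; congr (_ * _).
  rewrite -[(-1) ^+ i]signr_odd -[(-1) ^+ t i]signr_odd -!signr_addb.
  have -> : t = odd i (+) odd (t i) (+) s :> bool by rewrite {1}ts odd_lift_perm.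
  by congr (_ ^+ _); case: (odd i); case: (odd (t i)); case: (odd_perm s).
Qed.

Definition ext q r (w : form q r) : form q r.+1 := mk_form (ext_is_form w).

Definition face q (i : 'I_q.+2) (x : PT q.+1) : PT q := x \o lift i.

(* In the angle coordinates the face map is the linear map row' i; this is
   therefore also its differential. *)
Lemma face_expPT q (i : 'I_q.+2) (a : tangent q.+1) :
  face i (expPT a) = expPT (row' i a).
Proof.
by apply/funext => s; rewrite /face /expPT /=; congr expT; apply/rowP => k;
  rewrite !mxE.
Qed.

Definition pull_fun q r (i : 'I_q.+2) (w : form q r) (x : PT q.+1)
  (v : 'I_r -> tangent q.+1) : R := w (face i x) (fun j => row' i (v j)).

Lemma pull_is_form q r i w : is_form (@pull_fun q r i w).
Proof.
have [sw lw aw] := formP w.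
split=> [v|x v j c a b|x v t].
- rewrite /smooth (_ : _ \o _ =
    (fun y => w y (fun j => row' i (v j))) \o @expPT q \o (@row' R _ n i)).
    by apply: smoothV_comp_lin; [exact: row'_continuous|exact: sw].
  by apply/funext => a; rewrite /= /pull_fun face_expPT.
- have inn u : (fun k => row' i ([eta v with j |-> u] k)) =
      [eta (fun k => row' i (v k)) with j |-> row' i u].
    by apply/funext => k /=; case: eqP.
  by rewrite /pull_fun !inn linearP lw.
- exact: aw.
Qed.

Definition pull q r (i : 'I_q.+2) (w : form q r) : form q.+1 r :=
  mk_form (pull_is_form i w).

Definition d' q r (w : form q r) : form q.+1 r :=
  \sum_(i < q.+2) (-1) ^+ i *: pull i w.

Definition d'' q r (w : form q r) : form q r.+1 := (-1) ^+ q *: ext w.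

(* Families of forms indexed by the bidegree (q, r).  A family which has_degree m
   is an element of the degree m part, the direct sum of the form q r over the
   finitely many (q, r) with q + r = m, of the total complex. *)
Definition cochain := forall qr : nat * nat, form qr.1 qr.2.

Definition has_degree (m : nat) (w : cochain) : Prop :=
  forall qr, (qr.1 + qr.2 != m)%N -> w qr = 0.

(* w placed in bidegree (q, r) *)
Definition single q r (w : form q r) : cochain :=
  @dfwith _ (fun qr : nat * nat => form qr.1 qr.2) (fun=> 0) (q, r) w.

Definition tot_d (w : cochain) : cochain := fun qr =>
  let: (q, r) := qr return form qr.1 qr.2 in
  (if q is q'.+1 return form q r then d' (w (q', r)) else 0) +
  (if r is r'.+1 return form q r then d'' (w (q, r')) else 0).

(* t is a Chern-Simons form of the cocycle c, where c has degree m + 1. *)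
Definition chern_simons_form (m : nat) (c t : cochain) : Prop :=
  [/\ has_degree m.+1 c, tot_d c = (fun=> 0), has_degree m t & tot_d t = c].

Definition increasing p (k : {ffun 'I_p -> 'I_n}) : bool :=
  [forall s : 'I_p, forall t : 'I_p, (s < t)%N ==> (k s < k t)%N].

(* Indices: the paper's k_t in {1, ..., n} is k t in 'I_n; for s < p the inord
   below is the index s (resp. s + 1) of a factor of PT p.-1 (resp. PT p).
   Tmubar is meaningful for p >= 1 only. *)
Definition Tmubar p : form p.-1 p :=
  ((-1) ^+ (p * p.+1)./2 * (p`!%:R)^-1 * (1 / (2 * pi)) ^+ p) *:
  \sum_(k : {ffun 'I_p -> 'I_n} | increasing k)
    det_form (fun s t : 'I_p => dtheta (inord s : 'I_(p.-1).+1) (k t)).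

Definition mubar p : form p p :=
  ((-1) ^+ (p * p.-1)./2 * (p`!%:R)^-1 * (1 / (2 * pi)) ^+ p) *:
  \sum_(k : {ffun 'I_p -> 'I_n} | increasing k)
    det_form (fun s t : 'I_p =>
      dtheta (inord s : 'I_p.+1) (k t) - dtheta (inord s.+1 : 'I_p.+1) (k t)).

End Forms.

(* Main.v *)
From HB Require Import structures.
Require Import Defs.
From mathcomp Require Import all_boot all_order all_algebra reals.
From mathcomp Require Import all_fingroup boolp functions derive.
From mathcomp Require Import zify.

(** Every form in sight is a combination, with constant coefficients, of wedge
    products of the [dtheta]: it is translation invariant, so its exterior
    derivative vanishes ([d''_invariant]).  Everything therefore takes place in
    [d'], and since [d' (d' w) = 0] ([d'_d']) the cocycle condition on [mubar]
    follows from the single identity [d' Tmubar = mubar] ([d'_Tmubar]).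

    Pulling back along the [i]-th face renumbers the factors, sending the row
    index [s] to the [s]-th index distinct from [i].  So [d'] of a determinant
    with rows [a_0, ..., a_(p-1)] is the sum over [i] of [(-1)^i] times the
    determinant with rows [a_0, ..., a_p], row [a_i] being left out.  On the
    other side, the determinant with rows [a_s - a_(s+1)], [s < p], is expanded
    by additivity in each row: in a term without repeated rows one takes
    [a_s] for [s < i] and [- a_(s+1)] for [s >= i], for some [i <= p], whence
    the same sum up to the sign [(-1)^p] ([alternating_differences]).  That
    sign is the quotient of [(-1)^(p(p+1)/2)] by [(-1)^(p(p-1)/2)].

    The expansion uses only that the determinant is additive and alternating in
    its rows.  For the determinant of a matrix of 1-forms this is formal: the
    factors are multiplied in the order of the columns, so two equal rows make
    the terms of a permutation and of its composite with a transposition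
    cancel. *)

Set Implicit Arguments.
Unset Strict Implicit.
Unset Printing Implicit Defensive.

Import Order.TTheory GRing.Theory Num.Theory.
Local Open Scope ring_scope.

Lemma eq_oppr_0 (R : numFieldType) (V : lmodType R) (x : V) : x = - x -> x = 0.
Proof.
move=> xN; have /eqP : 2%:R *: x = 0 by rewrite scaler_nat mulr2n {1}xN addNr.
by rewrite scaler_eq0 pnatr_eq0 => /eqP.
Qed.

(** * Alternating functions of consecutive differences *)
Section AlternatingDifferences.
Variables (K : numFieldType) (V : zmodType) (M : lmodType K) (p : nat).
Variable D : ('I_p -> V) -> M.
Hypothesis D_rowB : forall u s x y,
  D [eta u with s |-> x - y] = D [eta u with s |-> x] - D [eta u with s |-> y].
Hypothesis D_alt : forall u s1 s2, s1 != s2 -> u s1 = u s2 -> D u = 0.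
Variable a : nat -> V.

(** The partial stages of the expansion, for [j <= l <= p]: the choice is [a_s]
    in the rows [s < j], [a_(s+1)] (without its sign) in the rows
    [j <= s < l], and the rows [s >= l] are still differences. *)
Definition mixed_rows (j l : nat) (s : 'I_p) : V :=
  if (s < j)%N then a s else if (s < l)%N then a s.+1 else a s - a s.+1.

(** Expanding the difference in row [l].  When [j < l] the choice [a_l] repeats
    row [l - 1], so that only the choice of [a_(l+1)] survives; when [l = j] both
    choices remain open. *)
Lemma mixed_rows_step j l : (j <= l < p)%N ->
  D (mixed_rows j l) =
  (if l == j then D (mixed_rows j.+1 j.+1) else 0) - D (mixed_rows j l.+1).
Proof.
move=> /andP[jl lp]; pose L := Ordinal lp.
pose u := mixed_rows j l.
have rowE f z : f L = z -> (forall s : 'I_p, (s : nat) != l -> f s = u s) ->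
    f = [eta u with L |-> z].
  by move=> fL h; apply/funext => s /=; case: eqVneq => [->|/h].
rewrite (rowE (mixed_rows j l) (a l - a l.+1)) //; last first.
  by rewrite /mixed_rows /= ltnn ltnNge jl.
rewrite D_rowB; congr (_ - D _); last first.
  apply/esym/rowE => [|s sl]; first by rewrite /mixed_rows /= ltnNge jl /= ltnSn.
  by rewrite /u /mixed_rows; do ?(case: ltnP => ? //); lia.
(* It remains to treat the term with [a l] in row [l]. *)
case: eqVneq => [lj|lj].
  congr D; apply/esym/rowE => [|s sl]; first by rewrite /mixed_rows /= lj ltnSn.
  by rewrite /u /mixed_rows lj; do ?(case: ltnP => ? //); lia.
have l1p : (l.-1 < p)%N by lia.
have nL : Ordinal l1p != L by rewrite -val_eqE /=; lia.
apply: (@D_alt _ (Ordinal l1p) L nL) => /=.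
rewrite eqxx (negPf nL) /u /mixed_rows /=.
(* Row [l - 1] lies in the middle range, hence is [a l] as well. *)
have -> : (l.-1 < j)%N = false by lia.
have -> : (l.-1 < l)%N by lia.
by rewrite prednK //; lia.
Qed.

(** Once some [a_(s+1)] has been chosen, all the later choices are forced. *)
Lemma mixed_rows_slide j l : (j < l <= p)%N ->
  D (mixed_rows j l) = (-1) ^+ (p - l) *: D (mixed_rows j p).
Proof.
move=> /andP[jl lp]; rewrite -{1}(subKn lp).
have: (p - l < p - j)%N by lia.
elim: (p - l)%N => [|m IH] mp; first by rewrite subn0 scale1r.
rewrite mixed_rows_step; last by lia.
rewrite ifF; last by lia.
rewrite sub0r subnSK; last by lia.
by rewrite IH ?exprS ?mulN1r ?scaleNr //; lia.
Qed.

(** The term of index [i] is the one in which [a_i] is skipped: the first row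
    where the choice is [a_(s+1)] is row [i].  Its sign counts the rows
    [s >= i]. *)
Lemma alternating_differences :
  D (fun s => a s - a s.+1) =
  \sum_(i < p.+1) (-1) ^+ (p - i) *: D (fun s => a (bump i s)).
Proof.
have bumpE j : (j <= p)%N -> mixed_rows j p = fun s : 'I_p => a (bump j s).
  move=> jp; apply/funext => s; rewrite /mixed_rows /bump ltn_ord.
  by case: ltnP => _; rewrite ?add0n ?add1n.
have -> : (fun s : 'I_p => a s - a s.+1) = mixed_rows 0 0 by [].
transitivity (\sum_(i < p.+1) (-1) ^+ (p - i) *: D (mixed_rows i p)); last first.
  by apply: eq_bigr => i _; rewrite bumpE // -ltnS.
rewrite -(big_mkord xpredT (fun i => (-1) ^+ (p - i) *: D (mixed_rows i p))).
rewrite big_nat_recr //= subnn scale1r.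
(* After the terms skipping some [a_i] with [i < j] are split off, the choice
   in all the rows [s < j] is [a_s]. *)
suff H j : (j <= p)%N -> D (mixed_rows 0 0) =
    \sum_(0 <= i < j) (-1) ^+ (p - i) *: D (mixed_rows i p) + D (mixed_rows j j).
  exact: H.
elim: j => [_|j IH jp]; first by rewrite big_nil add0r.
rewrite IH 1?ltnW // big_nat_recr //= -addrA; congr (_ + _).
rewrite mixed_rows_step; last by rewrite leqnn.
rewrite eqxx (@mixed_rows_slide j j.+1); last by rewrite leqnn.
by rewrite addrC -scaleNr -mulN1r -exprS subnSK.
Qed.

End AlternatingDifferences.

(** * Determinants of 1-forms as functions of their rows *)

Section Forms.
Variables (R : realType) (n : nat).
Local Notation form := (Defs.form R n).

Lemma form_addE q r (w1 w2 : form q r) x v : (w1 + w2) x v = w1 x v + w2 x v.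
Proof. by []. Qed.
Lemma form_oppE q r (w : form q r) x v : (- w) x v = - w x v.
Proof. by []. Qed.
Lemma form_scaleE q r c (w : form q r) x v : (c *: w) x v = c * w x v.
Proof. by []. Qed.

Definition form_valE := (form_addE, form_oppE, form_scaleE).

Lemma wedgeBl q r1 r2 (a b : form q r1) (w : form q r2) :
  wedge (a - b) w = wedge a w - wedge b w.
Proof.
apply: form_eqP => x v; rewrite !form_valE /= /wedge_fun -mulrBr; congr (_ * _).
rewrite -sumrB; apply: eq_bigr => s _.
by rewrite !form_valE mulrBl mulrBr.
Qed.

Lemma wedgeBr q r1 r2 (w : form q r1) (a b : form q r2) :
  wedge w (a - b) = wedge w a - wedge w b.
Proof.
apply: form_eqP => x v; rewrite !form_valE /= /wedge_fun -mulrBr; congr (_ * _).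
rewrite -sumrB; apply: eq_bigr => s _.
by rewrite !form_valE !mulrBr.
Qed.

Lemma wedge_prodB q p (a : 'I_p -> form q 1) t x y :
  wedge_prod [eta a with t |-> x - y] =
  wedge_prod [eta a with t |-> x] - wedge_prod [eta a with t |-> y].
Proof.
elim: p a t => [|p IH] a t; first by case: t.
have [j ->|->] := unliftP ord0 t.
  have E z : (fun t => [eta a with lift ord0 j |-> z] (lift ord0 t)) =
      [eta (a \o lift ord0) with j |-> z].
    exact: (eta_comp _ _ _ (@lift_inj _ ord0)).
  by rewrite /= -/(wedge_prod _) !E IH wedgeBr.
have E z : (fun t => [eta a with ord0 |-> z] (lift ord0 t)) = a \o lift ord0.
  by apply: eta_comp_out => k; rewrite eq_sym neq_lift.
by rewrite /= (E (x - y)) wedgeBl.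
Qed.

Lemma det_form_rowB q p (u : 'I_p -> 'I_p -> form q 1) s x y :
  det_form [eta u with s |-> x - y] =
  det_form [eta u with s |-> x] - det_form [eta u with s |-> y].
Proof.
rewrite /det_form -sumrB; apply: eq_bigr => t _; rewrite -scalerBr; congr (_ *: _).
have E z : (fun i => [eta u with s |-> z] (t i) i) =
    [eta (fun i => u (t i) i) with (t^-1)%g s |-> z ((t^-1)%g s)].
  apply/funext => i /=; rewrite -[i == _](inj_eq (@perm_inj _ t)) permKV.
  by case: eqP => // <-; rewrite permK.
by rewrite !E wedge_prodB.
Qed.

(** If rows [s1] and [s2] agree, composing a permutation with the transposition
    of [s1] and [s2] changes the sign of its term and nothing else. *)
Lemma det_form_alt q p (u : 'I_p -> 'I_p -> form q 1) s1 s2 :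
  s1 != s2 -> u s1 = u s2 -> det_form u = 0.
Proof.
move=> s12 us; apply: eq_oppr_0; rewrite /det_form -sumrN.
rewrite [LHS](reindex_inj (mulIg (tperm s1 s2))) /=; apply: eq_bigr => t _.
rewrite odd_permM odd_tperm s12 addbT signrN scaleNr; congr (- (_ *: wedge_prod _)).
by apply/funext => i; rewrite permM; case: tpermP => [->|->|//]; rewrite us.
Qed.

(** * Pullbacks and the simplicial differential *)

Lemma pull_is_linear q r (i : 'I_q.+2) : linear (@pull R n q r i).
Proof. by move=> c w1 w2; apply: form_eqP. Qed.

HB.instance Definition _ q r i :=
  GRing.isLinear.Build R _ _ _ (@pull R n q r i) (@pull_is_linear q r i).

Lemma d'_is_linear q r : linear (@d' R n q r).
Proof.
move=> c w1 w2; rewrite /d' scaler_sumr -big_split /=; apply: eq_bigr => i _.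
by rewrite linearP scalerDr !scalerA mulrC.
Qed.

HB.instance Definition _ q r :=
  GRing.isLinear.Build R _ _ _ (@d' R n q r) (@d'_is_linear q r).

Lemma pull_wedge q r1 r2 i (w1 : form q r1) (w2 : form q r2) :
  pull i (wedge w1 w2) = wedge (pull i w1) (pull i w2).
Proof. exact: form_eqP. Qed.

Lemma pull_wedge_prod q p i (a : 'I_p -> form q 1) :
  pull i (wedge_prod a) = wedge_prod (fun t => pull i (a t)).
Proof.
elim: p a => [|p IH] a; first exact: form_eqP.
by rewrite /= (pull_wedge (r1 := 1)) IH.
Qed.

Lemma pull_det_form q p i (a : 'I_p -> 'I_p -> form q 1) :
  pull i (det_form a) = det_form (fun s t => pull i (a s t)).
Proof.
rewrite /det_form linear_sum; apply: eq_bigr => s _.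
by rewrite linearZ /= pull_wedge_prod.
Qed.

Lemma pull_dtheta q (i : 'I_q.+2) s (k : 'I_n) :
  pull i (dtheta R s k) = dtheta R (lift i s) k.
Proof. by apply: form_eqP => x v; rewrite /= /pull_fun /= /dtheta_fun mxE. Qed.

(** The double sum over pairs [(j, i)] of faces is antisymmetric under the
    involution given by the simplicial identities, which exchanges the order in
    which two given factors are forgotten. *)
Lemma d'_d' q r (w : form q r) : d' (d' w) = 0.
Proof.
pose P (x : 'I_q.+3 * 'I_q.+2) := (-1) ^+ (x.1 + x.2) *: pull x.1 (pull x.2 w).
have -> : d' (d' w) = \sum_x P x.
  rewrite /d' -(pair_bigA _ (fun j i => P (j, i))) /=; apply: eq_bigr => j _.
  rewrite linear_sum scaler_sumr; apply: eq_bigr => i _.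
  by rewrite linearZ /= scalerA /P exprD.
have ub (x : 'I_q.+3 * 'I_q.+2) : (unbump x.2 x.1 < q.+2)%N.
  by case: x => -[j jq] [i iq]; rewrite /= /unbump; case: ltnP; lia.
(* [(j, i)] forgets the factor [j], then [lift j i]; [f (j, i)] forgets
   [lift j i] first, after which [j] has become number [unbump i j]. *)
pose f x := (lift x.1 x.2, Ordinal (ub x)).
have fK : involutive f.
  case=> -[j jq] [i iq]; congr (_, _); apply: val_inj => /=; rewrite /bump /unbump;
  by case: (leqP j i) => ? /=; case: leqP => /=; lia.
apply: eq_oppr_0; rewrite -sumrN [LHS](reindex_inj (inv_inj fK)) /=.
apply: eq_bigr => -[j i] _; rewrite /P /= -scaleNr.
have -> : (-1) ^+ (bump j i + unbump i j) = - (-1) ^+ (j + i) :> R.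
  rewrite -signr_odd -[in RHS]signr_odd -signrN; congr (_ ^+ _).
  congr nat_of_bool; rewrite /bump /unbump.
  by case: (leqP j i) => /=; lia.
congr (_ *: _); apply: form_eqP => x v; rewrite /= /pull_fun /= /pull_fun.
have L k : lift (lift j i) (lift (Ordinal (ub (j, i))) k) = lift j (lift i k).
  by apply: val_inj => /=; rewrite [RHS]bumpC.
congr (w _ _); first by apply/funext => k; rewrite /face /= L.
by apply/funext => k; apply/matrixP => s t; rewrite !mxE L.
Qed.

(** * Invariant forms are closed *)

Definition invariant q r (w : form q r) := forall x y v, w x v = w y v.

Lemma invariant_scale q r c (w : form q r) : invariant w -> invariant (c *: w).
Proof. by move=> wi x y v; rewrite !form_valE (wi x y). Qed.

Lemma invariant_sub q r (w1 w2 : form q r) :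
  invariant w1 -> invariant w2 -> invariant (w1 - w2).
Proof. by move=> i1 i2 x y v; rewrite !form_valE (i1 x y) (i2 x y). Qed.

Lemma invariant_sum q r I (s : seq I) (P : pred I) (F : I -> form q r) :
  (forall i, invariant (F i)) -> invariant (\sum_(i <- s | P i) F i).
Proof.
move=> Fi; apply: big_ind => // w1 w2 i1 i2 x y v.
by rewrite !form_valE (i1 x y) (i2 x y).
Qed.

Lemma invariant_wedge_prod q p (a : 'I_p -> form q 1) :
  (forall t, invariant (a t)) -> invariant (wedge_prod a).
Proof.
elim: p a => [|p IH] a ai x y v //=; rewrite /wedge_fun; congr (_ * _).
by apply: eq_bigr => s _; rewrite (ai ord0 x y) (IH _ _ x y).
Qed.

Lemma invariant_det_form q p (a : 'I_p -> 'I_p -> form q 1) :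
  (forall s t, invariant (a s t)) -> invariant (det_form a).
Proof.
move=> ai; apply: invariant_sum => s; apply: invariant_scale.
exact: invariant_wedge_prod.
Qed.

(** In the invariant frame the coefficients of an invariant form are constant
    functions, and their derivatives are all that enters [d'']. *)
Lemma d''_invariant q r (w : form q r) : invariant w -> d'' w = 0.
Proof.
move=> wi; apply: form_eqP => x v; rewrite form_valE /= /ext_fun big1 ?mulr0 //.
move=> i _; rewrite /Dinv derive1E.
rewrite (_ : (fun t => _) = cst (w x (v \o lift i))); last first.
  by apply/funext => t; exact: wi.
by rewrite derive_cst mulr0.
Qed.

(** * Cochains concentrated in one bidegree *)

Lemma single_in q r (w : form q r) : single w (q, r) = w.
Proof. exact: (@dfwith_in _ (fun qr : nat * nat => form qr.1 qr.2)). Qed.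

Lemma single_out q r (w : form q r) qr : (q, r) != qr -> single w qr = 0.
Proof. exact: (@dfwith_out _ (fun qr : nat * nat => form qr.1 qr.2)). Qed.

Lemma single0 q r : single (0 : form q r) = fun=> 0.
Proof.
apply/functional_extensionality_dep => qr.
by have [<-|/single_out //] := eqVneq (q, r) qr; rewrite single_in.
Qed.

Lemma has_degree_single q r (w : form q r) : has_degree (q + r) (single w).
Proof.
by move=> qr /eqP ne; apply: single_out; apply/eqP => e; case: ne; rewrite -e.
Qed.

Lemma tot_d_single q r (w : form q r) :
  d'' w = 0 -> tot_d (single w) = single (d' w).
Proof.
move=> w0; apply/functional_extensionality_dep => -[a b].
rewrite /tot_d -[RHS]addr0; congr (_ + _).
  case: a => [|a]; first by rewrite single_out.
  have [[<- <-]|/eqP ne] := (q, r) =P (a, b); first by rewrite !single_in.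
  by rewrite !single_out ?linear0 //; apply: contra ne => /eqP[-> ->].
case: b => [//|b].
have [[<- <-]|/eqP ne] := (q, r) =P (a, b); first by rewrite single_in.
by rewrite single_out // d''_invariant.
Qed.

(** * The Chern-Simons identity *)

(** Both sides are alternating sums, over [i <= p + 1], of the determinant whose
    rows are the factors other than the [i]-th: on the left by the definition of
    [d'], on the right by [alternating_differences]. *)
Lemma d'_det_dtheta p (k : 'I_p.+1 -> 'I_n) :
  d' (det_form (fun s t => dtheta R (inord s : 'I_p.+1) (k t))) =
  (-1) ^+ p.+1 *: det_form (fun s t =>
    dtheta R (inord s : 'I_p.+2) (k t) - dtheta R (inord s.+1 : 'I_p.+2) (k t)).
Proof.
pose a s (t : 'I_p.+1) := dtheta R (inord s : 'I_p.+2) (k t).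
have /= -> := alternating_differences (@det_form_rowB p.+1 p.+1)
  (@det_form_alt p.+1 p.+1) a.
rewrite scaler_sumr; apply: eq_bigr => i _.
rewrite scalerA -exprD.
have -> : (-1) ^+ (p.+1 + (p.+1 - i)) = (-1) ^+ i :> R.
  rewrite -signr_odd -[RHS]signr_odd oddD oddB -1?ltnS ?ltn_ord //.
  by rewrite addbA addbb.
rewrite pull_det_form; congr (_ *: det_form _).
apply/funext => s; apply/funext => t; rewrite pull_dtheta; congr dtheta.
apply: val_inj; rewrite /= !inordK //; have := ltn_ord s; rewrite /bump; lia.
Qed.

(** The normalising constants differ by the sign [(-1)^(p+1)], which
    [d'_det_dtheta] compensates. *)
Lemma d'_Tmubar p : d' (Tmubar R n p.+1) = mubar R n p.+1.
Proof.
have sgn : (-1) ^+ (p.+1 * p)./2 = (-1) ^+ (p.+1 * p.+2)./2 * (-1) ^+ p.+1 :> R.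
  rewrite -exprD -signr_odd -[RHS]signr_odd; congr (_ ^+ nat_of_bool _).
  have -> : ((p.+1 * p.+2)./2 = p.+1 + (p.+1 * p)./2)%N by lia.
  by rewrite addnAC addnn oddD odd_double.
(* The sign is generalised so that simplification does not unfold its
   exponent. *)
rewrite /Tmubar /mubar sgn; move: ((-1) ^+ (_ * p.+2)./2) => e.
rewrite linearZ linear_sum /=.
rewrite (eq_bigr _ (fun (k : {ffun 'I_p.+1 -> 'I_n}) _ => d'_det_dtheta k)).
rewrite -scaler_sumr scalerA; congr (_ *: _).
by rewrite mulrAC [e / _ * _]mulrAC.
Qed.

Lemma invariant_Tmubar p : invariant (Tmubar R n p).
Proof.
by apply: invariant_scale; apply: invariant_sum => k; apply: invariant_det_form.
Qed.

Lemma invariant_mubar p : invariant (mubar R n p).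
Proof.
apply: invariant_scale; apply: invariant_sum => k; apply: invariant_det_form => s t.
exact: invariant_sub.
Qed.

End Forms.

Theorem theorem3p4 (R : realType) (n p : nat) (hn : (1 <= n)%N)
    (hp : (1 <= p)%N) :
  chern_simons_form (p.-1 + p) (single (mubar R n p)) (single (Tmubar R n p)).
Proof.
case: p hp => [//|p] _ /=; split.
- by rewrite -addSn; exact: has_degree_single.
- rewrite tot_d_single; last exact/d''_invariant/invariant_mubar.
  by rewrite -d'_Tmubar d'_d' single0.
- exact: has_degree_single.
- rewrite tot_d_single ?d'_Tmubar //.
  by apply: (@d''_invariant _ _ p p.+1); exact: (@invariant_Tmubar _ _ p.+1).
Qed.
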